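(* Let $Q$ be a residually finite quandle. Suppose that, for each $n \geq 1$, $Q$ admits only finitely many congruences of index $n$. Then the endomorphism monoid $\mathrm{End}(Q)$ is a residually finite monoid and the automorphism group $\mathrm{Aut}(Q)$ is a residually finite group.
   Context: A quandle is a non-empty set $Q$ with a binary operation $*$ such that (Q1) $x*x=x$ for all $x\in Q$; (Q2) for all $x,y\in Q$ there is a unique $z\in Q$ with $x=z*y$ (write $z=x*^{-1}y$); (Q3) $(x*y)*z=(x*z)*(y*z)$ for all $x,y,z\in Q$. A homomorphism of quandles is a map preserving $*$; $\mathrm{End}(Q)$ is the monoid (under composition) of all quandle endomorphisms of $Q$, and $\mathrm{Aut}(Q)$ is the group of all quandle automorphisms. A quandle $Q$ is residually finite if for any distinct $a,b\in Q$ there exist a finite quandle $F$ and a homomorphism $f:Q\to F$ with $f(a)\neq f(b)$. A congruence on $Q$ is an equivalence relation on $Q$ compatible with both $*$ and $*^{-1}$; its index is the cardinality of the quotient quandle $Q/\alpha$. A monoid (group) $M$ is residually finite if any two distinct elements are separated by a homomorphism from $M$ to a finite monoid (group). *)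

(* Defs.v *)
From HB Require Import structures.
From mathcomp Require Import all_boot.
From mathcomp Require Import boolp classical_sets functions cardinality.

Set Implicit Arguments.
Unset Strict Implicit.
Unset Printing Implicit Defensive.

Local Open Scope classical_set_scope.
Local Open Scope card_scope.

Reserved Notation "x *q y" (at level 40, left associativity).
Reserved Notation "x *q^-1 y" (at level 40, left associativity).

Declare Scope quandle_scope.
Delimit Scope quandle_scope with Qd.
Local Open Scope quandle_scope.

HB.mixin Record isQuandle (Q : Type) := {
  quandle_inhabited : inhabited Q ;
  qop : Q -> Q -> Q ;
  qopxx : forall x : Q, qop x x = x ;
  qop_uniq_div : forall x y : Q, exists! z, x = qop z y ;
  qopDr : forall x y z : Q, qop (qop x y) z = qop (qop x z) (qop y z)
}.

#[short(type="quandleType")]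
HB.structure Definition Quandle := { Q of isQuandle Q }.

Notation "x *q y" := (qop x y) : quandle_scope.

Definition qinv (Q : quandleType) (x y : Q) : Q :=
  projT1 (cid (qop_uniq_div x y)).

Notation "x *q^-1 y" := (qinv x y) : quandle_scope.

Lemma qinvP (Q : quandleType) (x y : Q) : x = (x *q^-1 y) *q y.
Proof. by rewrite /qinv; case: cid => z []. Qed.

Lemma qinv_uniq (Q : quandleType) (x y z : Q) : x = z *q y -> x *q^-1 y = z.
Proof. by rewrite /qinv; case: cid => w [_ /= wP] /wP. Qed.

Definition quandle_morphism (Q Q' : quandleType) (f : Q -> Q') : Prop :=
  {morph f : x y / x *q y}.

Definition residually_finite_quandle (Q : quandleType) : Prop :=
  forall a b : Q, a <> b ->
    exists (F : quandleType) (f : Q -> F),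
      [/\ finite_set [set: F], quandle_morphism f & f a <> f b].

Record congruence (Q : quandleType) (R : Q -> Q -> Prop) : Prop := Congruence {
  congr_refl : forall x, R x x ;
  congr_sym : forall x y, R x y -> R y x ;
  congr_trans : forall x y z, R x y -> R y z -> R x z ;
  congr_qop : forall x x' y y', R x x' -> R y y' -> R (x *q y) (x' *q y') ;
  congr_qinv : forall x x' y y', R x x' -> R y y' -> R (x *q^-1 y) (x' *q^-1 y')
}.

(* For an equivalence R, the underlying set of Q/R: with propositional and functional extensionality,
   two elements have equal classes exactly when they are related, and two
   relations are equal exactly when they relate the same pairs. *)
Definition quotient_classes (Q : Type) (R : Q -> Q -> Prop) : set (set Q) :=
  range (fun x => [set y | R x y]).

Definition has_index (Q : Type) (R : Q -> Q -> Prop) (n : nat) : Prop :=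
  quotient_classes R #= `I_n.

Definition residually_finite_monoid (M : monoidType) : Prop :=
  forall a b : M, a <> b ->
    exists (N : monoidType) (f : UMagmaMorphism.type M N),
      finite_set [set: N] /\ f a <> f b.

Definition residually_finite_group (G : groupType) : Prop :=
  forall a b : G, a <> b ->
    exists (H : groupType) (f : {multiplicative G -> H}),
      finite_set [set: H] /\ f a <> f b.

Section EndAut.
Variable Q : quandleType.

Record End : Type := MkEnd {
  end_fun :> Q -> Q ;
  end_morph : quandle_morphism end_fun
}.

Lemma end_ext (f g : End) : f =1 g -> f = g.
Proof.
case: f g => [f fM] [g gM] /= /funext fg; case: _ / fg gM => gM.
by rewrite (Prop_irrelevance gM fM).
Qed.

Fact end_id_morph : quandle_morphism (@id Q). Proof. by []. Qed.
Definition end_one := MkEnd end_id_morph.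

Fact end_comp_morph (f g : End) : quandle_morphism (f \o g).
Proof. by move=> x y /=; rewrite !end_morph. Qed.
Definition end_mul (f g : End) := MkEnd (end_comp_morph f g).

HB.instance Definition _ := gen_eqMixin End.
HB.instance Definition _ := gen_choiceMixin End.

Fact end_mulA : associative end_mul. Proof. by move=> f g h; apply: end_ext. Qed.
Fact end_1mul : left_id end_one end_mul. Proof. by move=> f; apply: end_ext. Qed.
Fact end_mul1 : right_id end_one end_mul. Proof. by move=> f; apply: end_ext. Qed.

HB.instance Definition _ := isMonoid.Build End end_mulA end_1mul end_mul1.

Record Aut : Type := MkAut {
  aut_fun :> Q -> Q ;
  aut_morph : quandle_morphism aut_fun ;
  aut_bij : bijective aut_fun
}.

Lemma aut_ext (f g : Aut) : f =1 g -> f = g.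
Proof.
case: f g => [f fM fB] [g gM gB] /= /funext fg; case: _ / fg gM gB => gM gB.
by rewrite (Prop_irrelevance gM fM) (Prop_irrelevance gB fB).
Qed.

Definition aut_one : Aut :=
  MkAut end_id_morph (@Bijective _ _ id id (fun=> erefl) (fun=> erefl)).

Fact aut_comp_morph (f g : Aut) : quandle_morphism (f \o g).
Proof. by move=> x y /=; rewrite !aut_morph. Qed.
Definition aut_mul (f g : Aut) :=
  MkAut (aut_comp_morph f g) (bij_comp (aut_bij f) (aut_bij g)).

Fact aut_inv_subproof (f : Aut) : exists g : Q -> Q, cancel f g /\ cancel g f.
Proof. by case: (aut_bij f) => g fK gK; exists g. Qed.
Definition aut_inv_fun (f : Aut) : Q -> Q := projT1 (cid (aut_inv_subproof f)).
Fact aut_funK (f : Aut) : cancel f (aut_inv_fun f).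
Proof. by rewrite /aut_inv_fun; case: cid => g []. Qed.
Fact aut_inv_funK (f : Aut) : cancel (aut_inv_fun f) f.
Proof. by rewrite /aut_inv_fun; case: cid => g []. Qed.
Fact aut_inv_morph (f : Aut) : quandle_morphism (aut_inv_fun f).
Proof.
by move=> x y; apply: (can_inj (aut_funK f)); rewrite aut_morph !aut_inv_funK.
Qed.
Definition aut_inv (f : Aut) : Aut :=
  MkAut (aut_inv_morph f) (Bijective (aut_inv_funK f) (aut_funK f)).

HB.instance Definition _ := gen_eqMixin Aut.
HB.instance Definition _ := gen_choiceMixin Aut.

Fact aut_mulA : associative aut_mul. Proof. by move=> f g h; apply: aut_ext. Qed.
Fact aut_1mul : left_id aut_one aut_mul. Proof. by move=> f; apply: aut_ext. Qed.
Fact aut_mul1 : right_id aut_one aut_mul. Proof. by move=> f; apply: aut_ext. Qed.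
Fact aut_Vmul : left_inverse aut_one aut_inv aut_mul.
Proof. by move=> f; apply: aut_ext => x; exact: aut_funK. Qed.
Fact aut_mulV : right_inverse aut_one aut_inv aut_mul.
Proof. by move=> f; apply: aut_ext => x; exact: aut_inv_funK. Qed.

HB.instance Definition _ :=
  isGroup.Build Aut aut_mulA aut_1mul aut_mul1 aut_Vmul aut_mulV.

End EndAut.

(* Main.v *)
From HB Require Import structures.
Require Import Defs.
From mathcomp Require Import all_boot.
From mathcomp Require Import perm.
From mathcomp Require Import boolp classical_sets functions cardinality.

Local Open Scope classical_set_scope.

(** The monoid [End Q] acts on the right, by precomposition, on the set
    [Hom(Q, F)] of morphisms from [Q] to a finite quandle [F].  This action
    detects any difference between endomorphisms [a] and [b]: if
    [a x <> b x], residual finiteness gives a finite [F] and a morphism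
    [f : Q -> F] with [f (a x) <> f (b x)], so [f \o a] and [f \o b] are
    different points of [Hom(Q, F)].  Automorphisms act in the same way, and by
    permutations.

    So it is enough that [Hom(Q, F)] is finite ([finite_quandle_morphisms]), for
    then its self-maps form a finite monoid and its permutations a finite group.
    The kernel of a morphism to [F] is a congruence of index between 1 and the
    cardinality of [F], so by hypothesis only finitely many kernels occur
    ([kernel_congruence], [kernel_has_index]).  A map with a given kernel of
    finite index is constant on finitely many classes and takes its values in a
    finite set, which leaves finitely many maps ([finite_factoring_maps]). *)

(** * Finite sets of maps *)

Lemma finite_set_enum {T : Type} (A : set T) : finite_set A ->
  exists (n : nat) (g : 'I_n -> T), injective g /\ range g = A.
Proof.
case=> n /card_esym/card_bijP[f f_bij].
exists n, (fun i : 'I_n => val (f (SigSub (@mem_set _ `I_n i (ltn_ord i))))); split.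
- move=> i j /val_inj /(bij_inj f_bij) /(congr1 val) ij; exact: val_inj.
- apply/seteqP; split=> [_ [i _ <-] | z Az]; first by apply/set_mem/valP.
  case: f_bij => f' _ f'K; pose k := f' (SigSub (mem_set Az)).
  exists (Ordinal (set_mem (valP k))) => //.
  rewrite (_ : SigSub _ = k) ?f'K //; exact: val_inj.
Qed.

(** A map that factors through [c] is determined by the finite relation formed by
    the pairs of numbers of [c x] and [h x], for [x] in [Q]. *)
Lemma finite_factoring_maps {Q C F : Type} (c : Q -> C) :
  finite_set (range c) -> finite_set [set: F] ->
  finite_set [set h : Q -> F | forall x y, c x = c y -> h x = h y].
Proof.
move=> /finite_set_enum[n [u [_ u_range]]] /finite_set_enum[m [v [_ v_range]]].
pose graph (h : Q -> F) : {set 'I_n * 'I_m} :=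
  [set p | `[< exists x, u p.1 = c x /\ v p.2 = h x >]]%SET.
have graph_inj :
    {in [set h : Q -> F | forall x y, c x = c y -> h x = h y] &,
      injective graph}.
  move=> h h' _ /set_mem /= h'P hh'; apply/funext => x.
  have [i _ ui] : range u (c x) by rewrite u_range; exists x.
  have [j _ vj] : range v (h x) by rewrite v_range.
  have : (i, j) \in graph h by rewrite inE; apply/asboolP; exists x.
  rewrite hh' inE => /asboolP[y /= [uiy vjy]].
  by rewrite -vj vjy; apply: h'P; rewrite -ui -uiy.
by rewrite -(eq_finite_set (inj_card_eq graph_inj)); apply: finite_finset.
Qed.

(** * Morphisms to a finite quandle *)

Lemma quandle_morphism_qinv {Q F : quandleType} (h : Q -> F) :
  quandle_morphism h -> {morph h : x y / qinv x y}.
Proof. by move=> hM x y; apply/esym/qinv_uniq; rewrite -hM -qinvP. Qed.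

Lemma kernel_congruence {Q F : quandleType} (h : Q -> F) :
  quandle_morphism h -> congruence (fun x y => h x = h y).
Proof.
move=> hM; split=> //.
- by move=> x y z -> ->.
- by move=> x x' y y' xx' yy'; rewrite !hM xx' yy'.
- by move=> x x' y y' xx' yy'; rewrite !(quandle_morphism_qinv h hM) xx' yy'.
Qed.

Lemma kernel_has_index {Q : quandleType} {F : Type} {m : nat} (h : Q -> F) :
  ([set: F] #= `I_m)%card ->
  exists k, (1 <= k <= m)%N /\ has_index (fun x y => h x = h y) k.
Proof.
move=> F_card; set K := fun x y => h x = h y.
(* A class of the kernel is the fibre of [h] over a value of [h]. *)
have K_le : (quotient_classes K #<= `I_m)%card.
  rewrite -(card_le_eqr F_card).
  have -> : quotient_classes K = (fun a => [set y | a = h y]) @` range h.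
    by rewrite /quotient_classes image_comp.
  exact: card_le_trans (card_image_le _ _) (card_leT _).
have [k K_k] : finite_set (quotient_classes K).
  by apply: card_le_finite K_le _; exists m.
exists k; split=> //.
rewrite -(card_le_II k m) -(card_le_eql K_k) K_le andbT.
case: k K_k => // K_0; have [x] := @quandle_inhabited Q.
have : quotient_classes K [set y | K x y] by exists x.
suff -> : quotient_classes K = set0 by [].
by apply/eqP; rewrite -(card_le0 nat) (card_le_eql K_0) II0.
Qed.

Lemma finite_quandle_morphisms {Q F : quandleType} :
  (forall n : nat, (1 <= n)%N ->
     finite_set [set R : Q -> Q -> Prop | congruence R /\ has_index R n]) ->
  finite_set [set: F] -> finite_set [set h : Q -> F | quandle_morphism h].
Proof.
move=> Q_congr F_fin; have [m F_card] := F_fin.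
pose D := \bigcup_(k in [set k | (1 <= k <= m)%N])
  [set R : Q -> Q -> Prop | congruence R /\ has_index R k].
pose compatible (R : Q -> Q -> Prop) :=
  [set h : Q -> F | forall x y, R x y -> h x = h y].
apply: (@sub_finite_set _ _ (\bigcup_(R in D) compatible R)).
  move=> h /= hM; have [k [k_bd hk]] := kernel_has_index h F_card.
  by exists (fun x y => h x = h y) => //; exists k => //; split=> //;
    apply: kernel_congruence.
apply: bigcup_finite.
  apply: bigcup_finite => [|k /= /andP[k_gt0 _]]; last exact: Q_congr.
  apply: sub_finite_set (finite_II m.+1) => k /= /andP[_].
  by rewrite ltnS.
move=> R [k _ [R_congr R_index]].
apply: sub_finite_set (finite_factoring_maps (fun x => [set y | R x y]) _ F_fin).
  move=> h hR x y cxy; apply: hR; rewrite -[R x y]/([set z | R x z] y) cxy.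
  exact: congr_refl.
by exists k.
Qed.

(** * Right actions on finite sets *)

(** The monoid of self-maps of [I] with composition in the order of application,
    which is the order for which right actions are morphisms. *)
Definition selfmap (I : finType) : Type := {ffun I -> I}.

HB.instance Definition _ (I : finType) := Finite.on (selfmap I).

Section SelfmapMonoid.
Variable I : finType.

Definition selfmap_one : selfmap I := [ffun i => i].
Definition selfmap_mul (s t : selfmap I) : selfmap I := [ffun i => t (s i)].

Fact selfmap_mulA : associative selfmap_mul.
Proof. by move=> s t r; apply/ffunP => i; rewrite !ffunE. Qed.
Fact selfmap_1mul : left_id selfmap_one selfmap_mul.
Proof. by move=> s; apply/ffunP => i; rewrite !ffunE. Qed.
Fact selfmap_mul1 : right_id selfmap_one selfmap_mul.
Proof. by move=> s; apply/ffunP => i; rewrite !ffunE. Qed.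

HB.instance Definition _ :=
  isMonoid.Build (selfmap I) selfmap_mulA selfmap_1mul selfmap_mul1.

End SelfmapMonoid.

Section RightAction.
Local Open Scope group_scope.

Lemma right_action_separates_monoid {M : monoidType} {I : finType}
    (act : I -> M -> I) :
  (forall i, act i 1 = i) -> (forall i a b, act i (a * b) = act (act i a) b) ->
  forall (a b : M) (i : I), act i a <> act i b ->
  exists (N : monoidType) (f : UMagmaMorphism.type M N),
    finite_set [set: N] /\ f a <> f b.
Proof.
move=> act1 actM a b i ab.
pose f (c : M) : selfmap I := [ffun j => act j c].
have f_morph : monoid_morphism f.
  split; first by apply/ffunP => j; rewrite !ffunE act1.
  by move=> c d; apply/ffunP => j; rewrite !ffunE actM.
pose f_build := isUMagmaMorphism.Build M (selfmap I) f f_morph.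
pose fM : UMagmaMorphism.type M (selfmap I) := HB.pack f f_build.
exists (selfmap I), fM; split; first exact: finite_finset.
by move=> /(congr1 (fun s : selfmap I => s i)); rewrite !ffunE.
Qed.

Lemma right_action_separates_group {G : groupType} {I : finType}
    (act : I -> G -> I) :
  (forall i, act i 1 = i) -> (forall i a b, act i (a * b) = act (act i a) b) ->
  forall (a b : G) (i : I), act i a <> act i b ->
  exists (H : groupType) (f : {multiplicative G -> H}),
    finite_set [set: H] /\ f a <> f b.
Proof.
move=> act1 actM a b i ab.
have act_inj c : injective (act^~ c).
  by apply: (@can_inj _ _ _ (act^~ c^-1)) => j; rewrite -actM mulgV act1.
pose f (c : G) : {perm I} := perm (act_inj c).
have f_mul : {morph f : c d / c * d}.
  by move=> c d; apply/permP => j; rewrite permM !permE actM.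
pose f_build := isMultiplicative.Build G {perm I} f f_mul.
pose fM : {multiplicative G -> {perm I}} := HB.pack f f_build.
exists {perm I}, fM; split; first exact: finite_finset.
by move=> /(congr1 (fun s : {perm I} => s i)); rewrite !permE.
Qed.

End RightAction.

(** * Precomposition *)

(** The points of the action are the numbers of the morphisms in an injective
    enumeration [ev] of [Hom(Q, F)], and [act i c] is the number of [ev i \o c];
    the laws of composition pass to [act] because [ev] is injective. *)
Lemma precomposition_action_separates {Q : quandleType} :
  residually_finite_quandle Q ->
  (forall n : nat, (1 <= n)%N ->
     finite_set [set R : Q -> Q -> Prop | congruence R /\ has_index R n]) ->
  forall a b : End Q, a <> b ->
  exists (n : nat) (act : 'I_n -> End Q -> 'I_n),
    [/\ forall i, act i 1%g = i,
        forall i c d, act i (c * d)%g = act (act i c) d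
      & exists i, act i a <> act i b].
Proof.
move=> Q_resfin Q_congr a b ab.
have [x abx] : exists x, a x <> b x.
  by apply: contra_notP ab => /forallNP ab; apply: end_ext => x; exact: contrapT (ab x).
have [F [f [F_fin fM fab]]] := Q_resfin _ _ abx.
have [n [ev [ev_inj ev_range]]] :=
  finite_set_enum _ (finite_quandle_morphisms Q_congr F_fin).
have evP h : quandle_morphism h -> exists i, ev i = h.
  move=> hM; have [i _ <-] : range ev h by rewrite ev_range.
  by exists i.
have evM i : quandle_morphism (ev i).
  by have : range ev (ev i) by []; rewrite ev_range.
have pre_ex i (c : End Q) : exists j, ev j = ev i \o c.
  by apply: evP => y z /=; rewrite end_morph evM.
pose act i c := projT1 (cid (pre_ex i c)).
have actE i c : ev (act i c) = ev i \o c by rewrite /act; case: cid.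
exists n, act; split.
- by move=> i; apply: ev_inj; rewrite actE.
- by move=> i c d; apply: ev_inj; rewrite !actE.
- have [i evi] := evP f fM; exists i => /(congr1 (ev^~ x)).
  by rewrite /= !actE evi.
Qed.

Definition end_of_aut {Q : quandleType} (f : Aut Q) : End Q :=
  MkEnd (aut_morph f).

Theorem theorem2p3 (Q : quandleType)
  (Q_resfin : residually_finite_quandle Q)
  (Q_congr : forall n : nat, (1 <= n)%N ->
     finite_set [set R : Q -> Q -> Prop | congruence R /\ has_index R n]) :
  residually_finite_monoid (End Q) /\ residually_finite_group (Aut Q).
Proof.
split=> [a b ab | a b ab].
  have [n [act [act1 actM [i iab]]]] :=
    precomposition_action_separates Q_resfin Q_congr _ _ ab.
  exact: right_action_separates_monoid act1 actM a b i iab.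
have end_ab : end_of_aut a <> end_of_aut b.
  by move=> e; apply: ab; apply: aut_ext => x; rewrite -[a x]/(end_of_aut a x) e.
have [n [act [act1 actM [i iab]]]] :=
  precomposition_action_separates Q_resfin Q_congr _ _ end_ab.
apply: (right_action_separates_group (fun j c => act j (end_of_aut c)) _ _ _ _ i iab).
  by move=> j; rewrite -[RHS]act1; congr (act j _); apply: end_ext.
by move=> j c d; rewrite -actM; congr (act j _); apply: end_ext.
Qed.
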